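(* Let $n\ge 1$, let $\Omega_1,\dots,\Omega_n$ be finite nonempty sets with $m_i=\#\Omega_i$, let $\Omega=\Omega_1\times\cdots\times\Omega_n$, let $1\le k\le n$, $\lambda>0$, and $0<\eta<1$. Let $\mathcal H_k^\lambda$ be the model class of degree $k$, and let $h_k=\sum_{\mathbf j} m_{j_1}\cdots m_{j_k}$, where $\mathbf j=\{j_1,\dots,j_k\}$ runs over all $k$-element subsets of $\{1,\dots,n\}$. Let $P$ be a probability distribution on $\Omega$ (the true distribution), and let the training data $\mathbf x_1,\dots,\mathbf x_l$ ($l\ge 1$) be drawn independently and identically distributed according to $P$. Then, with probability at least $1-\eta$, the inequality $$R(P_\alpha)\le R_{emp}(P_\alpha)+\phi(k,\lambda,\eta)$$ holds for all $P_\alpha\in\mathcal H_k^\lambda$, where $$\phi(k,\lambda,\eta):=-\ln\lambda\;\sqrt{\frac{h_k-\ln h_k+\ln 16+\ln l-\ln\eta}{l}}\,.$$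
   Context: Model class: $\mathcal H_k^\lambda$ is the set of probability distributions $Q$ on $\Omega$ such that $Q(\mathbf x)>\lambda$ for all $\mathbf x\in\Omega$ and $Q$ is a $k$-factor distribution, i.e. $Q(x_1,\dots,x_n)=\prod_{\mathbf j} q_{\mathbf j}(x_{j_1},\dots,x_{j_k})$, where $\mathbf j=\{j_1<\dots<j_k\}$ runs over all $k$-element subsets of $\{1,\dots,n\}$ and each $q_{\mathbf j}:\Omega_{j_1}\times\cdots\times\Omega_{j_k}\to(0,\infty)$ is a positive function. Risk and empirical risk: for a strictly positive probability distribution $Q$ on $\Omega$, $$R(Q):=-\sum_{\mathbf x\in\Omega}P(\mathbf x)\ln Q(\mathbf x),\qquad R_{emp}(Q):=-\frac1l\sum_{i=1}^{l}\ln Q(\mathbf x_i).$$ *)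

(* Defs.v *)
From mathcomp Require Import all_boot all_order all_algebra.
From mathcomp Require Import all_classical all_reals all_analysis.

Set Implicit Arguments.
Unset Strict Implicit.
Unset Printing Implicit Defensive.

Import Order.TTheory GRing.Theory Num.Theory.
Local Open Scope ring_scope.

Definition config (n : nat) (Om : 'I_n -> finType) : finType :=
  {dffun forall i : 'I_n, Om i}.

(* The product of the [Om i] over the [i] in [J] only. *)
Definition subconfig (n : nat) (Om : 'I_n -> finType) (J : {set 'I_n}) :
    finType :=
  {dffun forall i : {i : 'I_n | i \in J}, Om (val i)}.

Definition restrict (n : nat) (Om : 'I_n -> finType) (J : {set 'I_n})
    (x : config Om) : subconfig Om J :=
  [ffun i : {i : 'I_n | i \in J} => x (val i)].

Definition is_distribution (R : realType) (T : finType) (P : T -> R) : Prop :=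
  (forall x, 0 <= P x) /\ \sum_(x : T) P x = 1.

(* The factors attached to sets [J] with [#|J| != k] are irrelevant. *)
Definition is_k_factor (R : realType) (n : nat) (Om : 'I_n -> finType)
    (k : nat) (Q : config Om -> R) : Prop :=
  exists q : forall J : {set 'I_n}, subconfig Om J -> R,
    (forall J : {set 'I_n}, #|J| = k -> forall y, 0 < q J y) /\
    (forall x, Q x = \prod_(J : {set 'I_n} | #|J| == k) q J (restrict J x)).

Definition model_class (R : realType) (n : nat) (Om : 'I_n -> finType)
    (k : nat) (lambda : R) (Q : config Om -> R) : Prop :=
  [/\ is_distribution Q, forall x, lambda < Q x & is_k_factor k Q].

Definition h_ (n : nat) (Om : 'I_n -> finType) (k : nat) : nat :=
  (\sum_(J : {set 'I_n} | #|J| == k) \prod_(i in J) #|Om i|)%N.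

Definition risk (R : realType) (T : finType) (P Q : T -> R) : R :=
  - \sum_(x : T) P x * ln (Q x).

Definition emp_risk (R : realType) (T : finType) (l : nat)
    (s : {ffun 'I_l -> T}) (Q : T -> R) : R :=
  - (l%:R^-1 * \sum_(i < l) ln (Q (s i))).

(* Probability of the event [E] when the sample [s] consists of [l] independent
   draws from [P], i.e. under the [l]-fold product distribution. *)
Definition iid_prob (R : realType) (T : finType) (P : T -> R) (l : nat)
    (E : set {ffun 'I_l -> T}) : R :=
  \sum_(s : {ffun 'I_l -> T} | `[< E s >]) \prod_(i < l) P (s i).

Definition phi (R : realType) (n : nat) (Om : 'I_n -> finType) (l k : nat)
    (lambda eta : R) : R :=
  - ln lambda *
  Num.sqrt (((h_ Om k)%:R - ln (h_ Om k)%:R + ln 16 + ln l%:R - ln eta)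
            / l%:R).

(* Main.v *)
(** With [f = - ln Q], the gap [risk P Q - emp_risk s Q] is the deviation of the
    empirical mean of [f] from its mean. Here [0 <= f <= B = - ln lambda], and [f]
    lies in the span of the [h_k] indicators of local configurations. Let [M s]
    be the supremum of the deviations over all such [f]. Changing one sample
    point moves [M] by at most [B / l], so McDiarmid's method controls the
    exponential moments of [M - E M]. To bound [E M], centre [f] at [B / 2],
    expand it in a basis [e_1, .., e_d] orthonormal in [L^2(P)], with
    [d <= h_k + 1], and use that the deviation of each [e_j] has second moment
    at most [1 / l]; by AM-GM, [E M <= t * B^2 / 8 + d / (2 * t * l)] for all
    [t > 0]. A Chernoff bound then gives
    [P (M > B * sqrt (A / l)) <= exp ((h_k + 1) / 2 - A)], which is at most [eta]
    for the [A] under the root in [phi]. *)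

Require Import Defs.
From mathcomp Require Import all_boot all_order all_algebra.
From mathcomp Require Import all_classical all_reals all_analysis.
From mathcomp Require Import ring lra.

Set Implicit Arguments.
Unset Strict Implicit.
Unset Printing Implicit Defensive.

Import Order.TTheory GRing.Theory Num.Theory.
Import numFieldNormedType.Exports.
Local Open Scope classical_set_scope.
Local Open Scope ring_scope.

(** * Calculus: exponential inequalities for two-point distributions *)

Lemma le_of_derive_ge0 (R : realType) (f df : R -> R) :
  (forall x : R, is_derive x 1 f (df x)) -> (forall x : R, 0 <= x -> 0 <= df x) ->
  forall x : R, 0 <= x -> f 0 <= f x.
Proof.
move=> fd df0 x; rewrite le_eqVlt => /predU1P[<-//|x0].
have [|c] := MVT x0 (fun y _ => fd y).
  apply: derivable_within_continuous => y _.
  by have [] := fd y.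
rewrite in_itv /= => /andP[c0 _] fE.
by rewrite -subr_ge0 fE mulr_ge0 ?df0 ?subr_ge0 // ltW.
Qed.

(* The logarithm of the left-hand side has second derivative
   [u * (1 - u) <= 1 / 4] in [c], where [u := p * expR c / (1 - p + p * expR c)]. *)
Lemma bernoulli_mgf_le (R : realType) (p c : R) : 0 <= p <= 1 -> 0 <= c ->
  1 - p + p * expR c <= expR (p * c + c ^+ 2 / 8).
Proof.
move=> /andP[p0 p1] c0.
pose D x : R := 1 - p + p * expR x.
have D0 x : 0 < D x.
  have := expR_gt0 x; rewrite /D; have [->|pp] := eqVneq p 0; first lra.
  by move=> e0; rewrite ltr_wpDl ?subr_ge0// mulr_gt0// lt0r pp.
have dD (x : R) : is_derive x 1 D (p * expR x).
  by apply: is_derive_eq; rewrite /GRing.scale /= ; ring.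
(* [k] is the derivative of [p * x + x ^+ 2 / 8 - ln (D x)], rewritten with
   [p * expR x = D x - (1 - p)]. It vanishes at 0. *)
pose k x : R := x / 4 + p - 1 + (1 - p) * (D x)^-1.
have dk (x : R) : is_derive x 1 k (4^-1 - (1 - p) * (p * expR x) / D x ^+ 2).
  have DN := lt0r_neq0 (D0 x).
  have dV := is_deriveV DN (dD x).
  by apply: is_derive_eq; rewrite /GRing.scale /=; field.
have k0 x : 0 <= x -> 0 <= k x.
  move=> x0; have -> : 0 = k 0.
    by rewrite /k /D expR0; field; lra.
  apply: (le_of_derive_ge0 dk) x0 => y _.
  rewrite subr_ge0 ler_pdivrMr ?exprn_gt0//.
  rewrite /D; set e := p * expR y.
  (* AM-GM: [4 * (1 - p) * e <= (1 - p + e) ^+ 2]. *)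
  by have := sqr_ge0 (1 - p - e); nra.
(* [- N] is the quotient of the two sides of the goal. It equals 1 at 0, and its derivative is
   nonpositive because [k] is nonnegative. *)
pose N x : R := - (D x * expR (- (p * x + x ^+ 2 / 8))).
have dN (x : R) : is_derive x 1 N (D x * expR (- (p * x + x ^+ 2 / 8)) * k x).
  have DN := lt0r_neq0 (D0 x).
  apply: is_derive_eq; rewrite /GRing.scale /= /k.
  have -> : (1 - p) = D x - p * expR x by rewrite /D; ring.
  by field.
have N0 x : 0 <= x -> 0 <= D x * expR (- (p * x + x ^+ 2 / 8)) * k x.
  by move=> x0; rewrite mulr_ge0 ?k0// mulr_ge0 ?expR_ge0// ltW.
have := le_of_derive_ge0 dN N0 c0.
rewrite lerN2 expRN ler_pdivrMr ?expR_gt0//.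
have -> : D 0 * expR (- (p * 0 + 0 ^+ 2 / 8)) = 1.
  by rewrite expr0n/= !(mulr0, mul0r) addr0 oppr0 /D expR0; ring.
by rewrite mul1r.
Qed.

(** Convexity: the tangent at [q * c] lies below the graph at [0] and at [c], and averaging these
    two bounds with weights [1 - q] and [q] cancels the slope. *)
Lemma expR_le_chord (R : realType) (q c : R) : 0 <= q <= 1 ->
  expR (q * c) <= 1 - q + q * expR c.
Proof.
move=> /andP[q0 q1]; set m := q * c.
have e0 := expR_gt0 m.
have h0 : expR m * (1 - m) <= 1.
  rewrite mulrC -ler_pdivlMr// mul1r -expRN; exact: expR_ge1Dx.
have h1 : expR m * (1 + (c - m)) <= expR c.
  rewrite mulrC -ler_pdivlMr// -expRN -expRD; exact: expR_ge1Dx.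
have -> : expR m = (1 - q) * (expR m * (1 - m)) + q * (expR m * (1 + (c - m))).
  by rewrite /m; ring.
by apply: lerD; [rewrite -[leRHS]mulr1|]; apply: ler_wpM2l; rewrite ?subr_ge0.
Qed.

(** * Independent sampling: exponential and second moments *)

Section iid_sampling.
Variables (R : realType) (T : finType) (P : T -> R).
Hypothesis hP : is_distribution P.

Let P0 x : 0 <= P x. Proof. exact: hP.1. Qed.

Lemma distribution_inhabited : T.
Proof.
case: (pickP [pred x : T | true]) => [x _|T0]; first exact: x.
by have := hP.2; rewrite big_pred0// => /esym/eqP; rewrite oner_eq0.
Qed.

(** Hoeffding's lemma. Bounding [expR] by its chord replaces [X] by a two-point variable on [X m]
    and [X m + c] with the same mean, where [m] minimises [X]; [bernoulli_mgf_le] then applies. *)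
Lemma hoeffding_mgf_le (X : T -> R) (c : R) : (forall x y, X x - X y <= c) ->
  \sum_x P x * expR (X x) <= expR (\sum_x P x * X x + c ^+ 2 / 8).
Proof.
move=> Xc; have x0 := distribution_inhabited.
have [m Xm] : exists m, forall x, X m <= X x.
  case: (@arg_minP _ _ T x0 xpredT X isT) => m _ Xm.
  by exists m => x; exact: Xm.
have c0 : 0 <= c by rewrite (le_trans _ (Xc x0 x0))// subrr.
have sumP : \sum_x P x = 1 := hP.2.
have [p [p01 pE]] : exists p, 0 <= p <= 1 /\
    (\sum_x P x * X x = X m + p * c) /\
    \sum_x P x * expR (X x) <= expR (X m) * (1 - p + p * expR c).
  (* If [c = 0], then [X] is constant and division by zero gives [q x = 0], so [qE] and [q01] still
     hold. *)
  pose q x := (X x - X m) / c.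
  have qE x : X x = X m + q x * c.
    rewrite /q; have [c_eq0|cN0] := eqVneq c 0; last by field.
    have := Xc x m; have := Xm x; rewrite c_eq0; lra.
  have q01 x : 0 <= q x <= 1.
    rewrite /q; have [->|cN0] := eqVneq c 0; first by rewrite invr0 mulr0 lexx ler01.
    have cp : 0 < c by rewrite lt0r cN0.
    by rewrite divr_ge0 ?subr_ge0//= ler_pdivrMr// mul1r.
  have lin (a b : R) : \sum_x P x * (a + q x * b) = a + (\sum_x P x * q x) * b.
    under eq_bigr do rewrite mulrDr mulrA.
    by rewrite big_split/= -!mulr_suml sumP mul1r.
  exists (\sum_x P x * q x); split; [|split].
  - rewrite sumr_ge0/= => [|x _]; last by have /andP[? _] := q01 x; rewrite mulr_ge0.
    by rewrite -[leRHS]sumP ler_sum// => x _; have /andP[_ ?] := q01 x; rewrite ler_piMr.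
  - by rewrite -lin; apply: eq_bigr => x _; rewrite -qE.
  - have -> : 1 - \sum_x P x * q x + (\sum_x P x * q x) * expR c =
        1 + (\sum_x P x * q x) * (expR c - 1) by ring.
    rewrite -lin mulr_sumr ler_sum// => x _.
    rewrite [leRHS]mulrCA ler_wpM2l//.
    rewrite (qE x) expRD ler_pM2l ?expR_gt0//.
    rewrite (le_trans (expR_le_chord c (q01 x)))// le_eqVlt.
    by apply/orP; left; apply/eqP; ring.
case: pE => -> /le_trans; apply; rewrite -[in leRHS]addrA expRD ler_pM2l ?expR_gt0//.
exact: bernoulli_mgf_le.
Qed.

Definition iid_mean l (F : {ffun 'I_l -> T} -> R) : R :=
  \sum_(s : {ffun 'I_l -> T}) (\prod_i P (s i)) * F s.

Definition fcons l (x : T) (s : {ffun 'I_l -> T}) : {ffun 'I_l.+1 -> T} :=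
  [ffun i => if unlift ord0 i is Some j then s j else x].

Lemma fcons0 l x (s : {ffun 'I_l -> T}) : fcons x s ord0 = x.
Proof. by rewrite ffunE unlift_none. Qed.

Lemma fconsS l x (s : {ffun 'I_l -> T}) j : fcons x s (lift ord0 j) = s j.
Proof. by rewrite ffunE liftK. Qed.

(** Fubini for the first draw, which drives the inductions on [l] below. *)
Lemma iid_mean_fcons l (F : {ffun 'I_l.+1 -> T} -> R) :
  iid_mean F = \sum_x P x * iid_mean (fun s => F (fcons x s)).
Proof.
under eq_bigr do rewrite mulr_sumr.
rewrite pair_bigA /= /iid_mean.
pose g (p : T * {ffun 'I_l -> T}) := fcons p.1 p.2.
rewrite (reindex g) /=; last first.
  exists (fun s => (s ord0, [ffun j => s (lift ord0 j)])) => [[x s] _|s _] /=.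
    by rewrite /g /= fcons0; congr (_, _); apply/ffunP => j; rewrite ffunE fconsS.
  apply/ffunP => i; rewrite /g /=; case: (unliftP ord0 i) => [j ->|->].
    by rewrite fconsS ffunE.
  by rewrite fcons0.
apply: eq_bigr => -[x s] _; rewrite /g /= big_ord_recl fcons0 -mulrA; congr (_ * (_ * _)).
by apply: eq_bigr => j _; rewrite fconsS.
Qed.

Lemma iid_mean0 (F : {ffun 'I_0 -> T} -> R) s : iid_mean F = F s.
Proof.
rewrite /iid_mean (big_pred1 s) ?big_ord0 ?mul1r// => s'.
by apply/esym/eqP/ffunP => -[].
Qed.

Lemma iid_mean_cst l (c : R) : iid_mean (fun _ : {ffun 'I_l -> T} => c) = c.
Proof.
elim: l => [|l IH]; first by rewrite (iid_mean0 _ [ffun=> distribution_inhabited]).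
by rewrite iid_mean_fcons IH -mulr_suml hP.2 mul1r.
Qed.

(** Restricting the comparison to samples of positive probability matters later: orthonormal
    expansions are valid only where [P] is nonzero. *)
Lemma le_iid_mean l (F G : {ffun 'I_l -> T} -> R) :
  (forall s : {ffun 'I_l -> T}, (forall i, P (s i) != 0) -> F s <= G s) ->
  iid_mean F <= iid_mean G.
Proof.
move=> FG; apply: ler_sum => s _.
have [/forallP s0|/forallPn[i /negPn/eqP si0]] := boolP [forall i, P (s i) != 0].
  by apply: ler_wpM2l; [exact: prodr_ge0|exact: FG].
by rewrite (bigD1 i)//= si0 !mul0r.
Qed.

Lemma iid_meanD l (F G : {ffun 'I_l -> T} -> R) :
  iid_mean (fun s => F s + G s) = iid_mean F + iid_mean G.
Proof. by rewrite -big_split; apply: eq_bigr => s _; rewrite mulrDr. Qed.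

Lemma iid_meanZ l c (F : {ffun 'I_l -> T} -> R) :
  iid_mean (fun s => c * F s) = c * iid_mean F.
Proof. by rewrite mulr_sumr; apply: eq_bigr => s _; rewrite mulrCA. Qed.

Lemma iid_mean_sum l d (F : 'I_d -> {ffun 'I_l -> T} -> R) :
  iid_mean (fun s => \sum_j F j s) = \sum_j iid_mean (F j).
Proof. by rewrite exchange_big; apply: eq_bigr => s _; rewrite mulr_sumr. Qed.

(** Condition on the first draw [x]: the induction hypothesis handles the other draws, and the
    conditional mean [G x] varies by at most [c], so Hoeffding's lemma handles [x]. *)
Lemma mcdiarmid_mgf_le l (F : {ffun 'I_l -> T} -> R) (c : R) :
  (forall i (s s' : {ffun 'I_l -> T}),
     (forall j, j != i -> s j = s' j) -> F s - F s' <= c) ->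
  iid_mean (fun s => expR (F s)) <= expR (iid_mean F + l%:R * (c ^+ 2 / 8)).
Proof.
elim: l F => [|l IH] F Fc.
  by rewrite !(iid_mean0 _ [ffun=> distribution_inhabited]) mul0r addr0.
rewrite !iid_mean_fcons.
pose G x := iid_mean (fun s => F (fcons x s)).
apply: (@le_trans _ _ (\sum_x P x * expR (G x) * expR (l%:R * (c ^+ 2 / 8)))).
  apply: ler_sum => x _; rewrite -mulrA ler_wpM2l// -expRD; apply: IH.
  move=> i s s' ss'; apply: (Fc (lift ord0 i)) => j.
  case: (unliftP ord0 j) => [j' ->|->] ji; last by rewrite !fcons0.
  by rewrite !fconsS ss'//; apply: contra ji => /eqP->.
rewrite -mulr_suml -(natr1 l) mulrDl mul1r addrA [in leRHS]addrAC expRD.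
rewrite ler_wpM2r ?expR_ge0//; apply: hoeffding_mgf_le => x y.
rewrite lerBlDr -[c in leRHS](iid_mean_cst l) -iid_meanD.
apply: le_iid_mean => s _; rewrite -lerBlDr; apply: (Fc ord0) => j.
by case: (unliftP ord0 j) => [j' ->|->]; rewrite ?eqxx// !fconsS.
Qed.

(** Cross terms between distinct draws vanish by independence and centring. *)
Lemma iid_mean_sum_sqr l (g : T -> R) : \sum_x P x * g x = 0 ->
  iid_mean (fun s : {ffun 'I_l -> T} => (\sum_i g (s i)) ^+ 2) =
  l%:R * \sum_x P x * g x ^+ 2.
Proof.
move=> g0; elim: l => [|l IH].
  by rewrite (iid_mean0 _ [ffun=> distribution_inhabited]) big_ord0 expr0n mul0r.
rewrite iid_mean_fcons.
under eq_bigr => x _.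
  rewrite (_ : iid_mean _ = g x ^+ 2 + (2 * g x) *
     iid_mean (fun s : {ffun 'I_l -> T} => \sum_i g (s i)) + l%:R * \sum_x P x * g x ^+ 2).
    rewrite mulrDr mulrDr (_ : P x * (2 * g x * _) = (P x * g x) *
      (2 * iid_mean (fun s : {ffun 'I_l -> T} => \sum_i g (s i)))); last by ring.
    over.
  rewrite -IH -iid_meanZ -[in RHS](iid_mean_cst l (g x ^+ 2)) -!iid_meanD.
  apply: eq_bigr => s _; congr (_ * _); rewrite big_ord_recl fcons0.
  under eq_bigr do rewrite fconsS.
  by ring.
by rewrite !big_split/= -!mulr_suml g0 hP.2 -(natr1 l); ring.
Qed.

End iid_sampling.

(** * Orthonormal families in [L^2(P)] and deviations of empirical means *)

Section orthonormal_expansion.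
Variables (R : realType) (T : finType) (P : T -> R).
Hypothesis hP : is_distribution P.

Let P0 x : 0 <= P x. Proof. exact: hP.1. Qed.

Definition orthonormal d (e : nat -> T -> R) :=
  forall i j, (i < d)%N -> (j < d)%N ->
    \sum_x P x * (e i x * e j x) = (i == j)%:R.

(* Gram-Schmidt for a semi-definite form: null directions are dropped, so that
   the expansion only holds where [P] does not vanish. *)
Lemma gram_schmidt (I : Type) (r : seq I) (v : I -> T -> R) :
  exists d (e : nat -> T -> R), [/\ (d <= size r)%N, orthonormal d e &
    forall w : I -> R, exists c : nat -> R, forall x, P x != 0 ->
      \sum_(i <- r) w i * v i x = \sum_(j < d) c j * e j x].
Proof.
elim: r => [|i r [d [e [dr eo ew]]]].
  exists 0%N, (fun _ _ => 0); split=> // w.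
  by exists (fun=> 0) => x _; rewrite big_nil big_ord0.
pose a j := \sum_x P x * (v i x * e j x).
pose u x := v i x - \sum_(j < d) a j * e j x.
pose n2 := \sum_x P x * u x ^+ 2.
have n2_ge0 : 0 <= n2 by apply: sumr_ge0 => x _; rewrite mulr_ge0 ?sqr_ge0.
have ue j : (j < d)%N -> \sum_x P x * (u x * e j x) = 0.
  move=> jd; rewrite /u.
  transitivity (a j - \sum_(k < d) a k * \sum_x P x * (e k x * e j x)).
    under [X in _ - X]eq_bigr do rewrite mulr_sumr.
    rewrite exchange_big -sumrB; apply: eq_bigr => x _ /=.
    rewrite mulrBl mulrBr mulr_suml mulr_sumr; congr (_ - _).
    by apply: eq_bigr => k _; ring.
  rewrite (bigD1 (Ordinal jd))//= eo// eqxx mulr1 big1 ?addr0 ?subrr// => k kj.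
  by rewrite eo// (negPf (_ : (k : nat) != j))// mulr0.
have vE w c x : \sum_(i0 <- r) w i0 * v i0 x = \sum_(j < d) c j * e j x ->
    \sum_(i0 <- i :: r) w i0 * v i0 x =
    w i * u x + \sum_(j < d) (c j + w i * a j) * e j x.
  rewrite big_cons => ->; under [in RHS]eq_bigr do rewrite mulrDl -mulrA.
  by rewrite big_split/= -mulr_sumr /u; ring.
have [n20|n20] := eqVneq n2 0.
  have u0 x : P x != 0 -> u x = 0.
    move=> Px; have /eqP := n20; rewrite psumr_eq0; last first.
      by move=> y _; rewrite mulr_ge0 ?sqr_ge0.
    move=> /allP/(_ x (mem_index_enum _)).
    by rewrite mulf_eq0 (negPf Px) sqrf_eq0 => /eqP.
  exists d, e; split=> //= [|w]; first exact: leqW.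
  have [c cE] := ew w; exists (fun j => c j + w i * a j) => x Px.
  by rewrite (vE w c) ?cE// u0// mulr0 add0r.
have sn : Num.sqrt n2 != 0 by rewrite sqrtr_eq0 -ltNge lt0r n20.
have sn2 : Num.sqrt n2 ^+ 2 = n2 by rewrite sqr_sqrtr.
pose e' j := if (j < d)%N then e j else fun x => u x / Num.sqrt n2.
exists d.+1, e'; split=> //= [j k|w].
  rewrite !ltnS leq_eqVlt => /predU1P[->|jd]; rewrite leq_eqVlt => /predU1P[->|kd].
  - rewrite /e' ltnn eqxx.
    transitivity (n2 / Num.sqrt n2 ^+ 2); last by rewrite sn2 divff.
    by rewrite mulr_suml; apply: eq_bigr => x _; field.
  - rewrite /e' ltnn kd gtn_eqF//.
    transitivity ((\sum_x P x * (u x * e k x)) / Num.sqrt n2).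
      by rewrite mulr_suml; apply: eq_bigr => x _; field.
    by rewrite ue// mul0r.
  - rewrite /e' ltnn jd ltn_eqF//.
    transitivity ((\sum_x P x * (u x * e j x)) / Num.sqrt n2).
      by rewrite mulr_suml; apply: eq_bigr => x _; field.
    by rewrite ue// mul0r.
  - by rewrite /e' jd kd; exact: eo.
have [c cE] := ew w.
(* The new basis vector is the residual [u] divided by its norm, hence the factor [Num.sqrt n2] in
   its coefficient. *)
exists (fun j => if (j < d)%N then c j + w i * a j else w i * Num.sqrt n2) => x Px.
rewrite (vE w c) ?cE// big_ord_recr/= /e' ltnn [LHS]addrC; congr (_ + _).
  by apply: eq_bigr => j _; rewrite ltn_ord.
by field.
Qed.

Lemma orthonormal_parseval d e (c : nat -> R) : orthonormal d e ->
  \sum_x P x * (\sum_(j < d) c j * e j x) ^+ 2 = \sum_(j < d) c j ^+ 2.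
Proof.
move=> eo.
transitivity (\sum_(j < d) \sum_(k < d) c j * c k * \sum_x P x * (e j x * e k x)).
  under [RHS]eq_bigr do under eq_bigr do rewrite mulr_sumr.
  under [RHS]eq_bigr do rewrite exchange_big/=.
  rewrite [RHS]exchange_big/=; apply: eq_bigr => x _.
  rewrite expr2 mulr_suml mulr_sumr; apply: eq_bigr => j _.
  by rewrite !mulr_sumr; apply: eq_bigr => k _; ring.
apply: eq_bigr => j _.
rewrite (bigD1 j)//= eo// eqxx mulr1 big1 ?addr0// => k kj.
by rewrite eo// (negPf (_ : (j : nat) != k)) ?mulr0// eq_sym.
Qed.

Definition deviation l (s : {ffun 'I_l -> T}) (f : T -> R) : R :=
  \sum_x P x * f x - l%:R^-1 * \sum_i f (s i).

(** The left-hand side is the variance of [f] divided by [l], and a variance is at most the second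
    moment. *)
Lemma iid_mean_sqr_deviation_le l (f : T -> R) : (0 < l)%N ->
  iid_mean P (fun s : {ffun 'I_l -> T} => deviation s f ^+ 2) <=
  l%:R^-1 * \sum_x P x * f x ^+ 2.
Proof.
move=> l0; have lN0 : l%:R != 0 :> R by rewrite pnatr_eq0 -lt0n.
pose m := \sum_x P x * f x; pose g x := m - f x.
have Pg : \sum_x P x * g x = 0.
  rewrite /g; under eq_bigr do rewrite mulrBr.
  by rewrite sumrB -mulr_suml hP.2 mul1r subrr.
have -> : iid_mean P (fun s : {ffun 'I_l -> T} => deviation s f ^+ 2) =
    l%:R^-1 ^+ 2 * iid_mean P (fun s : {ffun 'I_l -> T} => (\sum_i g (s i)) ^+ 2).
  rewrite -iid_meanZ; apply: eq_bigr => s _; rewrite -exprMn; congr (_ * _ ^+ 2).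
  by rewrite sumrB sumr_const card_ord /deviation -/m -mulr_natl; field.
rewrite iid_mean_sum_sqr// mulrA (_ : _ ^+ 2 * _ = l%:R^-1); last by field.
rewrite ler_pM2l ?invr_gt0 ?ltr0n//.
have -> : \sum_x P x * g x ^+ 2 = \sum_x P x * f x ^+ 2 - m ^+ 2.
  transitivity (\sum_x (P x * f x ^+ 2 - 2 * m * (P x * f x) + m ^+ 2 * P x)).
    by apply: eq_bigr => x _; rewrite /g; ring.
  by rewrite big_split sumrB/= -!mulr_sumr -/m hP.2; ring.
by rewrite lerBlDr lerDl sqr_ge0.
Qed.

(** Deviations are linear in [f]. AM-GM with weight [t] separates the coefficients, which depend on
    [f], from the deviations of the basis, which do not; this makes the bound uniform in [f]. *)
Lemma deviation_orthonormal_le l (s : {ffun 'I_l -> T}) d e (c : nat -> R)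
    (f : T -> R) (b t : R) : (forall i, P (s i) != 0) -> orthonormal d e ->
  (forall x, P x != 0 -> f x = \sum_(j < d) c j * e j x) ->
  (forall x, `|f x| <= b) -> 0 < t ->
  deviation s f <= t / 2 * b ^+ 2 + (2 * t)^-1 * \sum_(j < d) deviation s (e j) ^+ 2.
Proof.
move=> sP eo fE fb t0.
have -> : deviation s f = \sum_(j < d) c j * deviation s (e j).
  rewrite /deviation; under [RHS]eq_bigr do rewrite mulrBr !mulr_sumr.
  rewrite sumrB exchange_big/= [X in _ = _ - X]exchange_big/= mulr_sumr.
  congr (_ - _); apply: eq_bigr => x _.
    (* Points of mass zero drop out of the true mean; the sample points have positive mass by
       [sP]. *)
    have [->|Px] := eqVneq (P x) 0.
      by rewrite mul0r big1// => j _; rewrite mul0r mulr0.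
    by rewrite fE// mulr_sumr; apply: eq_bigr => j _; ring.
  by rewrite fE// mulr_sumr; apply: eq_bigr => j _; ring.
(* By Parseval the left-hand side is the second moment of [f]. *)
have cb : \sum_(j < d) c j ^+ 2 <= b ^+ 2.
  rewrite -(orthonormal_parseval _ eo) -[leRHS]mul1r -hP.2 mulr_suml.
  apply: ler_sum => x _; have [->|Px] := eqVneq (P x) 0; first by rewrite !mul0r.
  rewrite ler_wpM2l// -fE// -real_normK ?num_real// lerXn2r ?nnegrE//.
  exact: le_trans (fb x).
apply: (@le_trans _ _ (t / 2 * \sum_(j < d) c j ^+ 2 +
    (2 * t)^-1 * \sum_(j < d) deviation s (e j) ^+ 2)); last first.
  by rewrite lerD2r ler_pM2l// divr_gt0.
rewrite !mulr_sumr -big_split; apply: ler_sum => j _ /=.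
set y := deviation _ _; rewrite -subr_ge0.
have -> : t / 2 * c j ^+ 2 + (2 * t)^-1 * y ^+ 2 - c j * y =
    (2 * t)^-1 * (t * c j - y) ^+ 2 by field; exact: lt0r_neq0.
by rewrite mulr_ge0 ?sqr_ge0// invr_ge0 mulr_ge0// ltW.
Qed.

End orthonormal_expansion.

(** * Uniform deviations over a bounded class in a finite-dimensional span *)

Section uniform_deviation.
Variables (R : realType) (T : finType) (P : T -> R).
Hypothesis hP : is_distribution P.

Let P0 x : 0 <= P x. Proof. exact: hP.1. Qed.

Variables (F : set (T -> R)) (B : R).
Hypothesis F_neq0 : F !=set0.
Hypothesis F_bounded : forall f, F f -> forall x, 0 <= f x <= B.
Variable l : nat.
Hypothesis l_gt0 : (0 < l)%N.

Let lR0 : 0 < l%:R :> R. Proof. by rewrite ltr0n. Qed.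

Definition max_deviation (s : {ffun 'I_l -> T}) : R :=
  sup [set deviation P s f | f in F].

Lemma deviation_le_max (s : {ffun 'I_l -> T}) f :
  F f -> deviation P s f <= max_deviation s.
Proof.
move=> Ff; apply: ub_le_sup; last by exists f.
(* The true mean is at most [B] and the empirical mean is nonnegative. *)
exists B => _ [h Fh <-]; rewrite lerBlDr -[leLHS]addr0; apply: lerD.
  rewrite -[leRHS]mul1r -hP.2 mulr_suml; apply: ler_sum => x _.
  by rewrite ler_wpM2l//; have /andP[] := F_bounded Fh x.
rewrite mulr_ge0 ?invr_ge0 ?ler0n// sumr_ge0// => i _.
by have /andP[] := F_bounded Fh (s i).
Qed.

Lemma max_deviation_le (s : {ffun 'I_l -> T}) b :
  (forall f, F f -> deviation P s f <= b) -> max_deviation s <= b.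
Proof.
move=> Fb; apply: ge_sup => [|_ [f Ff <-]]; last exact: Fb.
by have [f Ff] := F_neq0; exists (deviation P s f), f.
Qed.

(** One summand of the empirical mean changes, by at most [B / l] for every [f], and this uniform
    bound passes to the supremum. *)
Lemma max_deviation_bounded_diff i (s s' : {ffun 'I_l -> T}) :
  (forall j, j != i -> s j = s' j) ->
  max_deviation s - max_deviation s' <= B / l%:R.
Proof.
move=> ss'; rewrite lerBlDl; apply: max_deviation_le => f Ff.
rewrite -lerBlDl; apply: le_trans (lerB (lexx _) (deviation_le_max s' Ff)) _.
rewrite /deviation (bigD1 i)//= [X in _ - (_ - _ * X)](bigD1 i)//=.
rewrite (eq_bigr (fun j => f (s' j))); last by move=> j /ss' ->.
set S := \sum_(j | _) _.
rewrite (_ : _ - _ = (f (s' i) - f (s i)) / l%:R); last by ring.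
rewrite ler_pM2r ?invr_gt0//.
have /andP[_] := F_bounded Ff (s' i); have /andP[+ _] := F_bounded Ff (s i); lra.
Qed.

Variables (I : finType) (v : I -> T -> R).
Hypothesis F_span : forall f, F f ->
  exists w : I -> R, forall x, f x = \sum_i w i * v i x.

(* Subtracting [B / 2] does not change deviations but halves the range of [f];
   the span is enlarged by the constants to accommodate it. *)
Lemma iid_mean_max_deviation_le (t : R) : 0 < t ->
  iid_mean P max_deviation <= t * B ^+ 2 / 8 + #|I|.+1%:R / (2 * t * l%:R).
Proof.
move=> t0; pose v' (o : option I) : T -> R := if o is Some i then v i else fun=> 1.
have [d [e [dI eo ve]]] := gram_schmidt hP (enum {: option I}) v'.
rewrite -cardT card_option in dI.
apply: (@le_trans _ _ (iid_mean P (fun s : {ffun 'I_l -> T} =>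
    t / 2 * (B / 2) ^+ 2 + (2 * t)^-1 * \sum_(j < d) deviation P s (e j) ^+ 2))).
  apply: le_iid_mean => // s sP; apply: max_deviation_le => f Ff.
  have [w wE] := F_span Ff.
  have -> : deviation P s f = deviation P s (fun x => f x - B / 2).
    rewrite /deviation; under [in RHS]eq_bigr do rewrite mulrBr.
    rewrite !sumrB -mulr_suml hP.2 sumr_const card_ord -[(B / 2) *+ _]mulr_natl.
    by field; exact: lt0r_neq0.
  have [c cE] := ve (fun o => if o is Some i then w i else - (B / 2)).
  apply: (@deviation_orthonormal_le _ _ _ hP _ _ _ _ c) => // x => [Px|].
    rewrite -cE// wE big_enum (bigD1 None)//= mulr1 addrC; congr (_ - _).
    rewrite (reindex_omap Some id) => [|[]//]/=.
    by apply: eq_bigl => i; rewrite eqxx.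
  by have /andP[f0 fB] := F_bounded Ff x; rewrite ler_norml; apply/andP; split; lra.
rewrite iid_meanD iid_mean_cst// iid_meanZ iid_mean_sum.
apply: lerD; first by rewrite le_eqVlt; apply/orP; left; apply/eqP; field.
apply: (@le_trans _ _ ((2 * t)^-1 * (l%:R^-1 * d%:R))); last first.
  rewrite -(mulrC _^-1) [in leRHS]invfM -mulrA.
  by rewrite !ler_pM2l ?invr_gt0 ?mulr_gt0// ler_nat.
rewrite ler_pM2l ?invr_gt0 ?mulr_gt0//.
rewrite mulr_natr -[X in _ *+ X]card_ord -sumr_const; apply: ler_sum => j _.
apply: le_trans (iid_mean_sqr_deviation_le hP _ l_gt0) _.
under eq_bigr do rewrite expr2.
by rewrite eo ?ltn_ord// eqxx mulr1.
Qed.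

Lemma max_deviation_tail (A : R) : 0 < B -> 0 < A ->
  iid_mean P (fun s => (B * Num.sqrt (A / l%:R) < max_deviation s)%R%:R) <=
  expR (#|I|.+1%:R / 2 - A).
Proof.
move=> B0 A0; set u := Num.sqrt _.
have u0 : 0 < u by rewrite sqrtr_gt0 divr_gt0.
have uA : u ^+ 2 * l%:R = A.
  by rewrite sqr_sqrtr ?divr_ge0 ?ltW// divfK// lt0r_neq0.
have nz : (l%:R != 0 :> R) && (B != 0) && (u != 0) by rewrite !lt0r_neq0.
(* With [t = a / l] the dimension term becomes the constant [#|I|.+1 / 2]. The rest of the exponent,
   [a ^+ 2 * B ^+ 2 / (4 * l) - a * B * u], is minimal at this [a], with value [- A]. *)
pose a := 2 * u * l%:R / B; pose t := 2 * u / B.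
have a0 : 0 < a by rewrite !mulr_gt0 ?invr_gt0.
have t0 : 0 < t by rewrite !mulr_gt0 ?invr_gt0.
apply: (@le_trans _ _ (iid_mean P (fun s =>
    expR (- (a * B * u)) * expR (a * max_deviation s)))).
  apply: le_iid_mean => // s _; rewrite -expRD.
  have [lt_s|_] := ltP; last exact: expR_ge0.
  rewrite -[leLHS]expR0 ler_expR addrC subr_ge0 -mulrA.
  by rewrite ler_pM2l// ltW.
rewrite iid_meanZ.
have diff i (s s' : {ffun 'I_l -> T}) : (forall j, j != i -> s j = s' j) ->
    a * max_deviation s - a * max_deviation s' <= a * (B / l%:R).
  by move=> ss'; rewrite -mulrBr ler_pM2l// (@max_deviation_bounded_diff i).
apply: (le_trans (ler_wpM2l (expR_ge0 _) (mcdiarmid_mgf_le hP diff))).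
rewrite -expRD ler_expR iid_meanZ.
have := iid_mean_max_deviation_le t0; rewrite -(ler_pM2l a0).
set M := iid_mean _ _ => /(lerD (lexx (- (a * B * u)))) H.
rewrite addrA; apply: (le_trans (lerD H (lexx _))).
rewrite le_eqVlt; apply/orP; left; apply/eqP; rewrite -uA /a /t.
by move: nz => /andP[/andP[? ?] ?]; field; apply/and3P.
Qed.

End uniform_deviation.

(** * Linear structure of the logarithms of [k]-factor distributions *)

Lemma ln_prod (R : realType) (J : Type) (r : seq J) (p : pred J) (F : J -> R) :
  (forall j, p j -> 0 < F j) ->
  ln (\prod_(j <- r | p j) F j) = \sum_(j <- r | p j) ln (F j).
Proof.
(* Positivity of the partial products is carried along, as [lnM] requires it. *)
move=> F0; suff [] : ln (\prod_(j <- r | p j) F j) = \sum_(j <- r | p j) ln (F j)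
  /\ 0 < \prod_(j <- r | p j) F j by [].
apply: (big_rec2 (fun x y => ln x = y /\ 0 < x)); first by rewrite ln1.
move=> j y x pj [<- x0]; rewrite lnM ?posrE ?F0//.
by split => //; rewrite mulr_gt0 ?F0.
Qed.

Section k_factor.
Variables (R : realType) (n : nat) (Om : 'I_n -> finType) (k : nat).

Let ksets : {set {set 'I_n}} := [set J : {set 'I_n} | #|J| == k].

(** Index set of the indicators that span all [ln Q], encoded as dependent pairs so that its
    cardinality is the sum defining [h_]. *)
Definition local_config : finType :=
  {J : {J : {set 'I_n} | J \in ksets} & subconfig Om (val J)}.

Lemma card_subconfig (J : {set 'I_n}) : #|subconfig Om J| = (\prod_(i in J) #|Om i|)%N.
Proof. by rewrite card_dep_ffun foldrE big_map big_enum/= [RHS]big_sub. Qed.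

Lemma card_local_config : #|local_config| = h_ Om k.
Proof.
rewrite card_tagged sumnE big_map big_enum/= /h_.
rewrite [RHS](eq_bigl (mem ksets)); last by move=> J; rewrite !inE.
rewrite [RHS]big_sub; apply: eq_bigr => J _; exact: card_subconfig.
Qed.

Definition local_indicator (p : local_config) (x : config Om) : R :=
  (Defs.restrict (val (tag p)) x == tagged p)%:R.

(** The logarithm turns the product into a sum, and a function of [restrict J x] is a combination of
    indicators of the configurations on [J]. *)
Lemma ln_k_factor_span (Q : config Om -> R) : is_k_factor k Q ->
  exists w : local_config -> R, forall x, ln (Q x) = \sum_p w p * local_indicator p x.
Proof.
move=> [q [q0 qE]]; exists (fun p => ln (q (val (tag p)) (tagged p))) => x.
rewrite qE ln_prod => [|J /eqP Jk]; last exact: q0.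
rewrite (eq_bigl (mem ksets)); last by move=> J; rewrite !inE.
rewrite big_sub; transitivity (\sum_(J : {J : {set 'I_n} | J \in ksets})
  \sum_(y : subconfig Om (val J)) ln (q (val J) y) * (Defs.restrict (val J) x == y)%:R);
  last by rewrite sig_big_dep.
apply: eq_bigr => J _.
rewrite (bigD1 (Defs.restrict (val J) x))//= eqxx mulr1 big1 ?addr0// => y yx.
by rewrite eq_sym (negPf yx) mulr0.
Qed.

End k_factor.

(** * Numerical estimate and conclusion *)

(** For positive [h], [ln x <= x - 1] at [x = h / 2] gives [ln h <= h / 2 - 1 + ln 2], and
    [ln 16 = 4 * ln 2] covers the rest. *)
Lemma half_le_phi_radicand (R : realType) (h : nat) :
  h.+1%:R / 2 <= h%:R - ln h%:R + ln 16 :> R.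
Proof.
have ln2 : 2^-1 <= ln 2 :> R.
  by have := @le_ln1Dx R (- 2^-1) _; rewrite (_ : 1 - _ = 2^-1) ?lnV ?posrE//; lra.
have -> : ln 16 = 4 * ln 2 :> R.
  by rewrite (_ : 16 = 2 ^+ 4) ?lnXn ?mulr_natl// -natrX.
(* At [h = 0] the convention [ln 0 = 0] applies. *)
rewrite -natr1; have [->|h0] := posnP h; first by rewrite ln0//; lra.
have hR : 0 < h%:R :> R by rewrite ltr0n.
have := @le_ln1Dx R (h%:R / 2 - 1) _.
rewrite (_ : 1 + _ = h%:R / 2); last by ring.
rewrite ln_div ?posrE//; lra.
Qed.

Theorem theorem5 (R : realType) (n : nat) (hn : (1 <= n)%N)
    (Om : 'I_n -> finType) (hOm : forall i, (0 < #|Om i|)%N)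
    (k : nat) (hk1 : (1 <= k)%N) (hkn : (k <= n)%N)
    (lambda : R) (hlambda : 0 < lambda)
    (eta : R) (heta0 : 0 < eta) (heta1 : eta < 1)
    (P : config Om -> R) (hP : is_distribution P)
    (l : nat) (hl : (1 <= l)%N) :
  1 - eta <=
  iid_prob P
    [set s : {ffun 'I_l -> config Om} |
      forall Q : config Om -> R, model_class k lambda Q ->
        risk P Q <= emp_risk s Q + phi Om l k lambda eta].
Proof.
set E := [set s | _].
have probE : iid_prob P E = iid_mean P (fun s => `[< E s >]%:R).
  by rewrite /iid_prob big_mkcond; apply: eq_bigr => s _; rewrite mulr_natr mulrb.
pose F : set (config Om -> R) :=
  [set f | exists2 Q, model_class k lambda Q & f = fun x => - ln (Q x)].
(* An empty model class makes the event certain; otherwise the supremum runs over a nonempty set. *)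
have [[f0 Ff0]|F_eq0] := pselect (F !=set0); last first.
  apply: (@le_trans _ _ 1); first by rewrite lerBlDr lerDl ltW.
  rewrite probE -[leLHS](iid_mean_cst hP l); apply: le_iid_mean => // s _.
  rewrite asboolT// => Q hQ.
  by exfalso; apply: F_eq0; exists (fun x => - ln (Q x)), Q.
have Q_le1 Q x : is_distribution Q -> Q x <= 1.
  by move=> [Q0 <-]; rewrite (bigD1 x)//= lerDl sumr_ge0.
pose B := - ln lambda.
have F_bounded f : F f -> forall x, 0 <= f x <= B.
  move=> [Q [hQ Ql _] ->] x; rewrite oppr_ge0 ln_le0 ?Q_le1//= lerN2.
  by rewrite ler_ln ?posrE// ?(lt_trans hlambda) // ltW.
(* Any member [Q] has [lambda < Q x <= 1], which forces [lambda < 1]. *)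
have B0 : 0 < B.
  have [Q [hQ Ql _] _] := Ff0; have x := distribution_inhabited hP.
  by rewrite oppr_gt0 ln_lt0// hlambda (lt_le_trans (Ql x)) ?Q_le1.
have F_span f : F f -> exists w : local_config Om k -> R,
    forall x, f x = \sum_p w p * local_indicator R p x.
  move=> [Q [_ _ /ln_k_factor_span[w wE]] ->].
  exists (fun p => - w p) => x; rewrite wE -sumrN.
  by apply: eq_bigr => p _; rewrite mulNr.
pose h := h_ Om k.
pose A : R := h%:R - ln h%:R + ln 16 + ln l%:R - ln eta.
have lnl : 0 <= ln l%:R :> R by rewrite ln_ge0// ler1n.
have lneta : ln eta < 0 by rewrite ln_lt0 ?heta0.
have hA : h.+1%:R / 2 - A <= ln eta.
  by have := half_le_phi_radicand R h; rewrite /A; lra.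
have A0 : 0 < A.
  by have : 0 < h.+1%:R :> R by []; have := hA; lra.
have := max_deviation_tail hP (ex_intro _ f0 Ff0) F_bounded hl F_span B0 A0.
rewrite card_local_config => tail.
rewrite lerBlDr -[leLHS](iid_mean_cst hP l) probE.
have {}tail := le_trans tail (_ : expR (h.+1%:R / 2 - A) <= eta).
apply: le_trans (lerD (lexx _) (tail _)); last first.
  by rewrite -[leRHS](lnK heta0) ler_expR.
(* Each sample lies in [E] or has maximal deviation above the threshold, so the two indicators sum
   to at least 1. *)
rewrite -iid_meanD; apply: le_iid_mean => // s _.
have [_|/asboolPn/existsNP[Q /not_implyP[hQ /negP]]] := boolP `[< E s >].
  by rewrite lerDl.
rewrite -ltNge => lt_risk; rewrite add0r ler1n lt0b.
apply: lt_le_trans (deviation_le_max hP F_bounded s (_ : F (fun x => - ln (Q x)))).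
  have -> : deviation P s (fun x => - ln (Q x)) = risk P Q - emp_risk s Q.
    rewrite /deviation /risk /emp_risk sumrN mulrN; congr (_ - - _).
    by rewrite -sumrN; apply: eq_bigr => x _; rewrite mulrN.
  by rewrite ltrBrDl.
by exists Q.
Qed.
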